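(* Let $D_1,\dots,D_k$ be tree degree sequences on a common set of $n$ vertices without common leaves, such that at least $2k-4$ vertices are never-leaves. Then $D_1,\dots,D_k$ have edge-disjoint realizations, i.e. there exist pairwise edge-disjoint simple graphs $G_1,\dots,G_k$ on these vertices such that each $G_i$ has degree sequence $D_i$.
   Context: A tree degree sequence on $n$ vertices is a list of positive integers $d_1,\dots,d_n$ with $\sum_i d_i=2n-2$. $d_v^{(i)}$ denotes the entry of vertex $v$ in $D_i$. The sequences have no common leaves if for every vertex $v$ and index $i$, $d_v^{(i)}=1$ implies $d_v^{(j)}>1$ for all $j\ne i$. A never-leaf is a vertex $v$ with $d_v^{(i)}\ne 1$ for every $i$. *)

(* Defs.v *)
From mathcomp Require Import all_boot.

Set Implicit Arguments.
Unset Strict Implicit.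
Unset Printing Implicit Defensive.

(* Stated with [+ 2] on the left to avoid truncated subtraction at [n = 0]. *)
Definition tree_degree_sequence (n : nat) (d : 'I_n -> nat) : Prop :=
  (forall v, 0 < d v) /\ \sum_(v < n) d v + 2 = 2 * n.

Definition no_common_leaves (n k : nat) (D : 'I_k -> 'I_n -> nat) : Prop :=
  forall (v : 'I_n) (i j : 'I_k), j != i -> D i v = 1 -> 1 < D j v.

Definition never_leaves (n k : nat) (D : 'I_k -> 'I_n -> nat) : {set 'I_n} :=
  [set v | [forall i, D i v != 1]].

(* A simple graph is given by its adjacency relation. *)
Definition simple_graph (V : finType) (e : rel V) : Prop :=
  symmetric e /\ irreflexive e.

Definition degree (V : finType) (e : rel V) (v : V) : nat :=
  #|[set w | e v w]|.

Definition realizes (n : nat) (e : rel 'I_n) (d : 'I_n -> nat) : Prop :=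
  simple_graph e /\ forall v, degree e v = d v.

Definition edge_disjoint (V : finType) (e f : rel V) : Prop :=
  forall u v, ~~ (e u v && f u v).

Definition edge_disjoint_realizations (n k : nat) (D : 'I_k -> 'I_n -> nat) :
    Prop :=
  exists G : 'I_k -> rel 'I_n,
    (forall i, realizes (G i) (D i)) /\
    (forall i j, i != j -> edge_disjoint (G i) (G j)).

(* Main.v *)
(* Induction on the number of vertices. Suppose that v has degree 1 in D_i0 and
   degree 2 in all other sequences, and that w can spare one unit of its degree
   in D_i0. Delete v, lower D_i0 at w by one, and realize what remains. To put
   v back, join it to w in G_i0 and subdivide one edge of every other G_j,
   these edges forming a rainbow matching that avoids w. The matching is found
   greedily: the 2k-4 never-leaves bound the number of leaves of D_j, hence its
   degrees above 2, so that 2k-3 vertices cannot meet all edges of G_j.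
   A pair v, w with D_i0 w > 2 exists as soon as some degree exceeds 2, because
   a sequence has two more leaves than excess degree. If no degree exceeds 2, a
   never-leaf can serve as w, unless there are exactly 2k-4 of them (none if
   k < 2). In that case the number of vertices is even, and the zigzag paths of
   the Hamiltonian decomposition of the complete graph do the job. *)

Require Import Defs.
From mathcomp Require Import all_boot zify.

Set Implicit Arguments.
Unset Strict Implicit.
Unset Printing Implicit Defensive.

(** * Attaching a new vertex to a graph *)

Lemma card_set_sum (V : finType) (P : pred V) : #|[set x | P x]| = \sum_x P x.
Proof. by rewrite -sum1dep_card big_mkcond; apply: eq_bigr => x _; case: (P x). Qed.

(* For [N] a singleton this adds a pendant edge at [v]; for [N] an edge of [e]
   it subdivides that edge. *)
Definition attach (V : finType) (e : rel V) (v : V) (N : {set V}) : rel V :=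
  fun x y => [|| e x y && ~~ ((x \in N) && (y \in N)),
                 (x == v) && (y \in N) | (y == v) && (x \in N)].

Lemma attach_simple (V : finType) (e : rel V) v (N : {set V}) :
  v \notin N -> simple_graph e -> simple_graph (attach e v N).
Proof.
move=> vN [eS eI]; split=> [x y|x]; rewrite /attach.
  by rewrite eS [(y \in N) && _]andbC; congr (_ || _); rewrite orbC.
by rewrite eI /= orbb; case: eqP => //= ->; apply: negbTE.
Qed.

Lemma degree0 (V : finType) (e : rel V) x : degree e x = 0 -> e x =1 xpred0.
Proof. by move/eqP; rewrite cards_eq0 => /eqP/setP E y; have:= E y; rewrite !inE. Qed.

Lemma degree_attach_new (V : finType) (e : rel V) v (N : {set V}) :
  v \notin N -> degree e v = 0 -> degree (attach e v N) v = #|N|.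
Proof.
move=> vN /degree0 ev; apply: eq_card => y.
by rewrite inE /attach ev eqxx (negbTE vN) andbF orbF.
Qed.

(** A vertex of [N] gains [v] and loses its neighbours inside [N]; the loss is added on the left to
    avoid truncated subtraction. *)
Lemma degree_attach_old (V : finType) (e : rel V) v (N : {set V}) x :
    simple_graph e -> degree e v = 0 -> x != v ->
  degree (attach e v N) x + (x \in N) * #|[set y in N | e x y]|
    = degree e x + (x \in N).
Proof.
move=> [eS _] /degree0 ev xv; rewrite /degree; case xN: (x \in N); last first.
  rewrite mul0n !addn0; apply: eq_card => y.
  by rewrite !inE /attach xN (negbTE xv) !andbF andbT !orbF.
rewrite mul1n.
have ->: [set y | attach e v N x y] = v |: ([set y | e x y] :\: N).
  apply/setP=> y; rewrite !inE /attach xN (negbTE xv) /= andbT orbC.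
  by case: eqP => //= _; rewrite andbC.
rewrite cardsU1 !inE eS ev /= andbF /= -(cardsID N [set y | e x y]).
have ->: [set y | e x y] :&: N = [set y in N | e x y].
  by apply/setP=> y; rewrite !inE andbC.
move: #|_ :\: _| #|[set y in N | _]| => p q; lia.
Qed.

(** Old edges can only disappear, and the new ones join [v], isolated before, to disjoint sets. *)
Lemma attach_disjoint (V : finType) (e f : rel V) v (N M : {set V}) :
    simple_graph e -> simple_graph f -> degree e v = 0 -> degree f v = 0 ->
    [disjoint N & M] -> v \notin N -> v \notin M ->
  edge_disjoint e f -> edge_disjoint (attach e v N) (attach f v M).
Proof.
move=> [eS _] [fS _] /degree0 ev /degree0 fv dNM vN vM ef x y.
have dis z : ~~ ((z \in N) && (z \in M)).
  by apply/andP=> -[zN]; rewrite (disjointFr dNM zN).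
rewrite /attach; have [->|xv] /= := eqVneq x v.
  by rewrite ev fv (negbTE vN) (negbTE vM) /= !andbF !orbF.
have [->|yv] /= := eqVneq y v.
  by rewrite eS ev fS fv /=.
rewrite !orbF; apply: contra (ef x y).
by case/andP=> /andP[-> _] /andP[-> _].
Qed.

(** If every edge met [S], each edge at a vertex outside [S] would end in [S], so the degrees
    outside would sum to at most those inside. *)
Lemma free_edge (V : finType) (e : rel V) (S : {set V}) :
    simple_graph e ->
    2 * \sum_(v in S) degree e v < \sum_v degree e v ->
  exists a b, [/\ e a b, a \notin S & b \notin S].
Proof.
move=> [eS _] lt.
have [/existsP[a /existsP[b /and3P[]]]|/existsPn none] :=
  boolP [exists a, exists b, [&& e a b, a \notin S & b \notin S]].
  by exists a, b.
suff: \sum_v degree e v <= 2 * \sum_(v in S) degree e v by rewrite leqNgt lt.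
rewrite (bigID (mem S)) /= mul2n -addnn leq_add2l.
have degE v : degree e v = \sum_w e v w by exact: card_set_sum.
apply: (@leq_trans (\sum_(v | v \notin S) \sum_(w in S) e v w)).
  apply: leq_sum => v vS; rewrite degE (bigID (mem S)) /=.
  rewrite [X in _ + X]big1 ?addn0 // => w wS; move/existsPn/(_ w): (none v).
  by rewrite vS wS !andbT => /negbTE->.
rewrite exchange_big /=; apply: leq_sum => w _.
rewrite degE [leqRHS](bigID (mem S)) /= addnC.
under eq_bigr do rewrite eS.
exact: leq_addr.
Qed.

(* The vertex set is [A]; keeping [V] fixed and giving degree 0 to the vertices
   outside [A] lets vertices be deleted without changing types. *)
Record packing_instance (V : finType) (k : nat) (A : {set V})
    (D : 'I_k -> V -> nat) : Prop := PackingInstance {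
  pack_support : forall i v, (0 < D i v) = (v \in A);
  pack_sum : forall i, \sum_v D i v + 2 = 2 * #|A|;
  pack_leaves : forall v i j, j != i -> D i v = 1 -> 1 < D j v }.

Definition leaves (V : finType) (d : V -> nat) : {set V} := [set v | d v == 1].

Definition never_leaves_in (V : finType) (k : nat) (A : {set V})
    (D : 'I_k -> V -> nat) : {set V} :=
  [set v in A | [forall i, D i v != 1]].

(** * Counting leaves, never-leaves and excess degree *)

Section Counting.
Variables (V : finType) (k : nat) (A : {set V}) (D : 'I_k -> V -> nat).
Hypothesis pD : packing_instance A D.

Lemma pack_out i v : v \notin A -> D i v = 0.
Proof. by rewrite -(pack_support pD i) lt0n negbK => /eqP. Qed.

(** For [d > 0], [d + (d == 1) = 2 + (d - 2)] with truncated subtraction; sum this over [A]. *)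
Lemma card_leaves i : #|leaves (D i)| = 2 + \sum_v (D i v - 2).
Proof.
have: \sum_v (D i v + (D i v == 1)) 
    = \sum_v ((v \in A) + (v \in A) + (D i v - 2)).
  apply: eq_bigr => v _; rewrite -(pack_support pD i).
  by case: (D i v) => [|[|d]] //=; lia.
rewrite !big_split /= -!card_set_sum -/(leaves _) (_ : [set x in A] = A); last by apply/setP=> v; rewrite inE.
have:= pack_sum pD i; lia.
Qed.

Lemma leaf_index v i : D i v = 1 -> \sum_j (D j v == 1) = 1.
Proof.
move=> Div; rewrite (bigD1 i) //= Div eqxx big1 // => j ji.
by have:= pack_leaves pD ji Div; case: (D j v) => [|[]].
Qed.

(** Each vertex of [A] is either a never-leaf or a leaf of exactly one sequence. *)
Lemma sum_card_leaves :
  \sum_i #|leaves (D i)| + #|never_leaves_in A D| = #|A|.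
Proof.
under eq_bigr do rewrite card_set_sum.
rewrite exchange_big /= -!sum1_card [X in _ + X]big_mkcond.
rewrite [in RHS]big_mkcond -big_split /=; apply: eq_bigr => v _.
rewrite inE; case vA: (v \in A) => /=; last first.
  by rewrite big1 // => i _; rewrite pack_out ?vA.
have [/forallP nev|/forallPn[i]] := boolP [forall i, D i v != 1].
  by rewrite big1 // => i _; rewrite (negbTE (nev i)).
by rewrite negbK => /eqP /leaf_index->.
Qed.

(** Each of the other [k - 1] sequences has at least two leaves. *)
Lemma card_leaves_bound i :
  #|leaves (D i)| + 2 * k.-1 + #|never_leaves_in A D| <= #|A|.
Proof.
rewrite -sum_card_leaves leq_add2r (bigD1 i) //= leq_add2l.
have ->: 2 * k.-1 = \sum_(j | j != i) 2.
  by rewrite sum_nat_const cardC1 card_ord mulnC.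
by apply: leq_sum => j _; rewrite card_leaves leq_addr.
Qed.

(** The excess over degree 2 within [S] is at most the total excess, which is two less than the
    number of leaves. *)
Lemma sum_degree_bound i (S : {set V}) :
  \sum_(v in S) D i v + 2 <= 2 * #|S| + #|leaves (D i)|.
Proof.
rewrite card_leaves [leqRHS]addnCA addnC leq_add2l mulnC -sum_nat_const.
apply: (@leq_trans (\sum_(v in S) (2 + (D i v - 2)))).
  by apply: leq_sum => v _; lia.
rewrite big_split leq_add2l /=.
by rewrite [leqRHS](bigID (mem S)) leq_addr.
Qed.

(* [N j] is the edge chosen in [G j] for [j \in r], and [N i0] reserves [w]. *)
Lemma rainbow_matching (G : 'I_k -> rel V) i0 w (r : seq 'I_k) :
    (forall i, simple_graph (G i)) -> (forall i v, degree (G i) v = D i v) ->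
    2 * k - 4 <= #|never_leaves_in A D| -> uniq (i0 :: r) ->
  exists N : 'I_k -> {set V},
    [/\ N i0 = [set w],
        forall j, j \in r -> exists a b, N j = [set a; b] /\ G j a b,
        forall j, j \notin i0 :: r -> N j = set0,
        forall i j, i != j -> [disjoint N i & N j]
      & #|\bigcup_i N i| <= 2 * size r + 1].
Proof.
move=> sG dG nev; elim: r => [_|j r IH].
  pose N i := if i == i0 then [set w] else set0; exists N.
  split=> // [|i|i j ij|].
  - by rewrite /N eqxx.
  - by rewrite inE /N => /negbTE->.
  - rewrite /N; case: (eqVneq i i0) ij => [->|_ _]; last first.
      by rewrite -setI_eq0 set0I.
    by rewrite eq_sym => /negbTE->; rewrite -setI_eq0 setI0.
  - rewrite (bigD1 i0) //= big1 => [|i /negbTE ii0]; last by rewrite /N ii0.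
    by rewrite setU0 /N eqxx cards1.
rewrite [uniq _]/= inE negb_or => /and3P[/andP[i0j i0r] jr ur].
have {IH}[|N [Ni0 Nr No Nd Nc]] := IH; first by rewrite /= i0r.
set S := \bigcup_i N i in Nc.
have rk : size r + 2 <= k.
  have: size (undup (i0 :: j :: r)) <= #|'I_k|.
    by rewrite -(card_uniqP (undup_uniq _)) max_card.
  by rewrite undup_id ?card_ord /= ?inE ?negb_or ?i0j ?i0r ?jr //= addn2.
(* By [rk], [S] has at most [2k - 3] vertices. Their degrees then sum to at most [#|A| - 2], whereas
   [G j] has [#|A| - 1] edges. *)
have [|a [b [Gab aS bS]]] := @free_edge _ (G j) S (sG j).
  under eq_bigr do rewrite dG; under [ltnRHS]eq_bigr do rewrite dG.
  have:= pack_sum pD j; have:= sum_degree_bound j S.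
  have:= card_leaves_bound j; lia.
pose M i := if i == j then [set a; b] else N i.
have NS i x : x \in N i -> x \in S by move=> xN; apply/bigcupP; exists i.
have dS i : [disjoint [set a; b] & N i].
  rewrite disjoint_subset; apply/subsetP=> x; rewrite !inE.
  by case/orP=> /eqP->; [apply: contra aS|apply: contra bS] => /NS.
exists M; split=> [|i|i|i1 i2|].
- by rewrite /M (negbTE i0j).
- rewrite inE /M; case: eqP => [-> _|_ /Nr//]; by exists a, b.
- rewrite !inE !negb_or /M => /and3P[ii0 /negbTE-> ir]; apply: No.
  by rewrite inE negb_or ii0.
- rewrite /M; case: (eqVneq i1 j) => [->|_]; case: (eqVneq i2 j) => // _ ne.
  + by rewrite disjoint_sym.
  + exact: Nd.
- have sub : \bigcup_i M i \subset S :|: [set a; b].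
    apply/bigcupsP=> i _; rewrite /M; case: eqP => _; first exact: subsetUr.
    by apply: subset_trans (subsetUl _ _); apply: bigcup_sup.
  apply: leq_trans (subset_leq_card sub) _.
  have:= (leq_card_setU S [set a; b]).1; rewrite cards2 /=; lia.
Qed.

(* Otherwise every leaf of a sequence with a degree above 2 has excess in
   another such sequence, so these sequences together would have at most as
   many leaves as excess degree. *)
Lemma branching_leaf i w : 2 < D i w ->
  exists i0 v x, [/\ D i0 v = 1, forall j, j != i0 -> D j v = 2 & 2 < D i0 x].
Proof.
move=> Diw; pose P := [pred i | [exists x, 2 < D i x]].
have [/existsP[i0 /existsP[v /and3P[/existsP[x Dx] /eqP Dv /forallP Dj]]]|none] :=
  boolP [exists i0, exists v,
    [&& P i0, D i0 v == 1 & [forall j, (j != i0) ==> (D j v == 2)]]].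
  by exists i0, v, x; split=> // j ji; have:= Dj j; rewrite ji => /eqP.
(* By [card_leaves] the left side exceeds the right by 2 for each sequence in [P], and [P] contains
   [i]. *)
suff: \sum_(i in P) #|leaves (D i)| <= \sum_(i in P) \sum_v (D i v - 2).
  under eq_bigr do rewrite card_leaves.
  rewrite big_split /= -[X in _ <= X]add0n leq_add2r.
  by rewrite (bigD1 i) //=; apply/existsP; exists w.
under eq_bigr do rewrite card_set_sum.
rewrite exchange_big [leqRHS]exchange_big; apply: leq_sum => v _ /=.
have [/existsP[i1 /andP[Pi1 /eqP Dv]]|/existsPn no] :=
  boolP [exists i1, P i1 && (D i1 v == 1)]; last first.
  rewrite big1 // => j Pj; have:= no j; rewrite -/(P j).
  by rewrite [P j]Pj /= => /negbTE->.
(* As [v] is a leaf of only one sequence, it suffices to find one unit of excess at [v]. *)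
apply: (@leq_trans 1).
  rewrite -[leqRHS](leaf_index Dv) [leqRHS](bigID (mem P)) /=.
  exact: leq_addr.
have /existsP[j] : [exists j, (j != i1) && (D j v != 2)].
  move/existsPn/(_ i1)/existsPn/(_ v): none.
  rewrite [P i1]Pi1 Dv eqxx /= => /forallPn[j]; rewrite negb_imply => jj.
  by apply/existsP; exists j.
case/andP=> ji Djv; have Djv1:= pack_leaves pD ji Dv.
have Djv2 : 2 < D j v by lia.
rewrite (bigD1 j) /=; last by apply/existsP; exists v.
by apply: ltn_addr; rewrite subn_gt0.
Qed.

End Counting.

(** * Zigzag paths, for degrees at most 2 *)

Section Zigzag.
Variables (V : finType) (A : {set V}) (s : seq V) (m : nat).
Hypotheses (s_uniq : uniq s) (s_mem : s =i A) (s_size : size s = 2 * m).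

(* For [a, b < 2m] this says that [a + b] is [2i] or [2i + 1] modulo [2m]. *)
Definition zigzag (i a b : nat) : bool :=
  a + b \in [:: 2 * i; 2 * i + 1; 2 * i + 2 * m; 2 * i + 1 + 2 * m].

Definition zigzag_graph (i : nat) : rel V := fun u v =>
  [&& u \in A, v \in A, u != v & zigzag i (index u s) (index v s)].

Lemma zigzag_graph_simple i : simple_graph (zigzag_graph i).
Proof.
split=> [u v|u]; rewrite /zigzag_graph; last by rewrite eqxx !andbF.
by rewrite /zigzag addnC eq_sym andbCA.
Qed.

(** The index sum of an edge modulo [2m], halved and rounded down, recovers [i]. *)
Lemma zigzag_graph_disjoint i j :
  i < m -> j < m -> i != j -> edge_disjoint (zigzag_graph i) (zigzag_graph j).
Proof.
move=> im jm ij u v; apply/negP=> /andP[/and4P[uA vA _ zi] /and4P[_ _ _ zj]].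
move: zi zj; rewrite /zigzag !inE; lia.
Qed.

(** Two positions complete [p] to an admissible sum. One of them is [p] itself exactly when [p] is
    [i] or [m + i], the ends of the path. *)
Lemma degree_zigzag_graph i v : i < m -> v \in A ->
  degree (zigzag_graph i) v + ((index v s == i) || (index v s == m + i)) = 2.
Proof.
move=> im vA; set p := index v s.
have pm : p < 2 * m by rewrite -s_size index_mem s_mem.
(* The residue of [2i + e - p] modulo [2m]: the position of the candidate neighbour with sum
   [2i + e]. *)
pose c e := if p <= 2 * i + e then 2 * i + e - p else 2 * i + e + 2 * m - p.
have cP e : c e + p = 2 * i + e \/ 2 * i + e < p /\ c e + p = 2 * i + e + 2 * m.
  by rewrite /c; case: (leqP p); lia.
have cm e : e < 2 -> c e < 2 * m by have := cP e; lia.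
pose q e := nth v s (c e).
have indq e : e < 2 -> index (q e) s = c e.
  by move=> e2; rewrite index_uniq // s_size cm.
have qA e : e < 2 -> q e \in A by move=> e2; rewrite -s_mem mem_nth // s_size cm.
have qE e y : e < 2 -> y \in A -> (y == q e) = (index y s == c e).
  move=> e2; rewrite -s_mem => ys; apply/eqP/eqP=> [->|E]; first exact: indq.
  by rewrite /q -E nth_index.
have q01 : q 0 != q 1 by rewrite (qE 1) ?qA // indq //; have := cP 0; have := cP 1; lia.
have <- : #|[set q 0; q 1]| = 2 by rewrite cards2 q01.
rewrite (cardsD1 v) addnC !inE !qE // -/p; congr (nat_of_bool _ + _).
  by have := cP 0; have := cP 1; lia.
apply: eq_card => y; rewrite !inE /zigzag_graph vA /= eq_sym.
case: (boolP (y \in A)) => yA /=; last first.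
  have ny e : e < 2 -> (y == q e) = false.
    by move=> e2; apply: contraNF yA => /eqP->; apply: qA.
  by rewrite !ny ?andbF.
rewrite !qE // /zigzag -/p !inE; congr (_ && _).
have: index y s < 2 * m by rewrite -s_size index_mem s_mem.
by have := cP 0; have := cP 1; lia.
Qed.

End Zigzag.

Definition packs (V : finType) (k : nat) (D : 'I_k -> V -> nat)
    (G : 'I_k -> rel V) : Prop :=
  [/\ forall i, simple_graph (G i), forall i v, degree (G i) v = D i v
    & forall i j, i != j -> edge_disjoint (G i) (G j)].

Lemma paths_pack (V : finType) (k : nat) (A : {set V}) (D : 'I_k -> V -> nat) q :
    packing_instance A D -> (forall i v, D i v <= 2) ->
    #|never_leaves_in A D| = 2 * q ->
  exists G, packs D G.
Proof.
move=> pD D2 nevq.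
have L2 i : #|leaves (D i)| = 2.
  by rewrite (card_leaves pD) big1 // => v _; have:= D2 i v; lia.
have cA : #|A| = 2 * (k + q).
  rewrite -(sum_card_leaves pD) nevq; under eq_bigr do rewrite L2.
  rewrite sum_nat_const card_ord; lia.
have /fin_all_exists[f fP] i :
    exists ab : V * V, leaves (D i) = [set ab.1; ab.2].
  by have /eqP/cards2P[a [b [_ E]]] := L2 i; exists (a, b).
pose N := enum (never_leaves_in A D).
(* The two halves have length [k + q], so the leaves of [D i] sit at positions [i] and [k + q + i],
   the ends of the [i]-th zigzag path. *)
pose s := ([seq (f i).1 | i <- enum 'I_k] ++ take q N) ++
          ([seq (f i).2 | i <- enum 'I_k] ++ drop q N).
have szN : size N = 2 * q by rewrite -cardE.
have szh g : size ([seq g i | i <- enum 'I_k] ++ take q N : seq V) = k + q.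
  by rewrite size_cat size_map size_enum_ord size_take szN; case: ifP; lia.
have szs : size s = 2 * (k + q).
  by rewrite size_cat szh size_cat size_map size_enum_ord size_drop szN; lia.
have leafE i v : (D i v == 1) = (v == (f i).1) || (v == (f i).2).
  by have/setP/(_ v) := fP i; rewrite !inE.
have sub : {subset enum A <= s}.
  move=> v; rewrite mem_enum => vA; rewrite !mem_cat.
  have [nev|] := boolP (v \in never_leaves_in A D).
    have: v \in take q N ++ drop q N by rewrite cat_take_drop mem_enum.
    by rewrite mem_cat => /orP[]->; rewrite !orbT.
  rewrite inE vA /= => /forallPn[i]; rewrite negbK leafE.
  have i_enum : i \in enum 'I_k by rewrite mem_enum.
  case/orP=> /eqP->.
    by rewrite (map_f (fun i => (f i).1) i_enum).
  by rewrite (map_f (fun i => (f i).2) i_enum) ?orbT.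
have szA : size s <= size (enum A) by rewrite -cardE cA szs.
(* A list that covers [A] and is no longer than [A] has no repetitions. *)
have us := leq_size_uniq (enum_uniq _) sub szA.
have [_ memA] := uniq_min_size (enum_uniq _) sub szA.
have sA : s =i A by move=> v; rewrite -memA mem_enum.
have ltk (i : 'I_k) : i < k + q by rewrite ltn_addr.
have ind1 (i : 'I_k) : index (f i).1 s = i.
  rewrite -(@index_uniq _ (f i).1 i s) //; last by rewrite szs; have:= ltn_ord i; lia.
  congr index; rewrite nth_cat szh ltk nth_cat size_map size_enum_ord ltn_ord.
  by rewrite (nth_map i) ?size_enum_ord // nth_ord_enum.
have ind2 (i : 'I_k) : index (f i).2 s = k + q + i.
  rewrite -(@index_uniq _ (f i).2 (k + q + i) s) //; last first.
    by rewrite szs; have:= ltn_ord i; lia.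
  congr index; rewrite nth_cat szh ltnNge leq_addr /= addKn nth_cat size_map.
  by rewrite size_enum_ord ltn_ord (nth_map i) ?size_enum_ord // nth_ord_enum.
have indE (i : 'I_k) v x : v \in A -> x \in A ->
    (v == x) = (index v s == index x s).
  rewrite -!sA => vs xs; apply/eqP/eqP=> [->//|E].
  by rewrite -(nth_index v vs) E nth_index.
have leafA (i : 'I_k) x : D i x == 1 -> x \in A.
  by move/eqP=> E; rewrite -(pack_support pD i) E.
exists (fun i => zigzag_graph A s (k + q) i); split=> [i|i v|i j ij].
- exact: zigzag_graph_simple.
- have [vA|vA] := boolP (v \in A); last first.
    rewrite (pack_out pD) //; apply/eqP; rewrite cards_eq0; apply/eqP/setP=> y.
    by rewrite !inE /zigzag_graph (negbTE vA).
  have := degree_zigzag_graph us sA szs (ltk i) vA.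
  rewrite -ind2 -[X in index v s == X]ind1 -!indE // ?(leafA i) ?leafE ?eqxx ?orbT //.
  rewrite -leafE; have:= D2 i v; have:= pack_support pD i v; rewrite vA.
  lia.
- exact: zigzag_graph_disjoint.
Qed.

(** * Deleting a leaf and putting it back *)

Definition delete_leaf (V : finType) (k : nat) (D : 'I_k -> V -> nat) i0 v w :
    'I_k -> V -> nat :=
  fun i u => if u == v then 0 else D i u - ((i == i0) && (u == w)).

Section DeleteLeaf.
Variables (V : finType) (k : nat) (A : {set V}) (D : 'I_k -> V -> nat).
Variables (i0 : 'I_k) (v w : V).
Hypotheses (pD : packing_instance A D) (leaf_v : D i0 v = 1).
Hypotheses (deg2_v : forall j, j != i0 -> D j v = 2) (Dw : 1 < D i0 w).

Let D' := delete_leaf D i0 v w.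

Lemma leaf_neq : w != v.
Proof. by apply: contraTneq Dw => ->; rewrite leaf_v. Qed.

Lemma delete_leafK i u : u != v -> D' i u + ((i == i0) && (u == w)) = D i u.
Proof.
rewrite /D' /delete_leaf => /negbTE->.
case: andP => [[/eqP-> /eqP->]|_]; last by rewrite subn0 addn0.
by rewrite subnK // ltnW.
Qed.

(** Every degree sum drops by 2: through [v] and [w] in [D i0], through [v] alone elsewhere. The
    premise covers the case where [w] becomes a leaf. *)
Lemma delete_leaf_instance :
    (D i0 w = 2 -> forall j, j != i0 -> 1 < D j w) ->
  packing_instance (A :\ v) D'.
Proof.
move=> Dw2; have vA : v \in A by rewrite -(pack_support pD i0) leaf_v.
split=> [i u|i|u i j ji].
- rewrite !inE; have [->|uv] := eqVneq u v; first by rewrite /D' /delete_leaf eqxx.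
  rewrite /= -(pack_support pD i); have := delete_leafK i uv.
  by case: andP => [[/eqP-> /eqP->]|_] /=; lia.
- have := pack_sum pD i; rewrite (cardsD1 v A) vA (bigD1 v) //=.
  rewrite [in X in _ -> X](bigD1 v) //= {1}/D' /delete_leaf eqxx add0n.
  rewrite -(eq_bigr _ (fun u => @delete_leafK i u)) big_split /=.
  have [->|ii0] := eqVneq i i0; last first.
    by rewrite deg2_v // [X in _ + (_ + X)]big1 //; lia.
  rewrite leaf_v [X in _ + (_ + X)](bigD1 w) ?leaf_neq //= eqxx.
  rewrite [X in _ + (_ + (_ + X))]big1 => [|u /andP[_ /negbTE->//]].
  lia.
- have [->|uv] := eqVneq u v; first by rewrite /D' /delete_leaf eqxx.
  have := delete_leafK i uv; have := delete_leafK j uv.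
  have := @pack_leaves _ _ _ _ pD u i j ji.
  case: (eqVneq u w) => [->|_]; rewrite ?andbF ?andbT; last by lia.
  have [ei|_] := eqVneq i i0; have [ej|_] := eqVneq j i0; first by rewrite ei ej eqxx in ji.
  + have : D i w = 2 -> 1 < D j w by rewrite ei => /Dw2; apply; rewrite -ei.
    lia.
  + have iN : i != i0 by rewrite -ej eq_sym.
    have [E|] := eqVneq (D i0 w) 2; first by have := Dw2 E i iN; lia.
    by rewrite ej; move: Dw; lia.
  + by lia.
Qed.

(** The leaf [v] was no never-leaf, and only [w] can cease to be one, when its degree in [D i0]
    drops from 2 to 1. *)
Lemma never_leaves_delete_leaf :
  #|never_leaves_in A D| <= #|never_leaves_in (A :\ v) D'| + (D i0 w == 2).
Proof.
have sub u : u \in never_leaves_in A D -> (D i0 w == 2) && (u == w) = false ->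
    u \in never_leaves_in (A :\ v) D'.
  rewrite !inE => /andP[uA /forallP nev] uw.
  have uv : u != v by apply: contraTneq (nev i0) => ->; rewrite leaf_v.
  rewrite uv uA; apply/forallP=> i; have := nev i; have := delete_leafK i uv.
  case: andP => [[/eqP ei /eqP eu]|_] /=; last by lia.
  by move: uw Dw; rewrite ei eu eqxx andbT; lia.
case E: (D i0 w == 2) sub => sub; last first.
  by rewrite addn0; apply/subset_leq_card/subsetP=> u /sub; apply.
rewrite (cardsD1 w) addnC leq_add ?leq_b1 //.
by apply/subset_leq_card/subsetP=> u /setD1P[/negbTE uw /sub]; apply.
Qed.

Lemma reinsert_leaf G :
    packing_instance (A :\ v) D' ->
    2 * k - 4 <= #|never_leaves_in (A :\ v) D'| ->
  packs D' G -> exists G', packs D G'.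
Proof.
move=> pD' nev [sG dG disG].
have [|N [Ni0 Nr _ Nd _]] :=
    @rainbow_matching _ _ _ _ pD' G i0 w (enum (predC1 i0)) sG dG nev.
  by rewrite /= mem_enum !inE eqxx enum_uniq.
have Gv i : degree (G i) v = 0 by rewrite dG /D' /delete_leaf eqxx.
have NE i : i != i0 -> exists a b, [/\ N i = [set a; b], G i a b & a != b].
  move=> ii0; have [|a [b [E Gab]]] := Nr i; first by rewrite mem_enum.
  exists a, b; split=> //; apply: contraTneq Gab => ->.
  by rewrite (sG i).2.
have vN i : v \notin N i.
  have [->|/NE[a [b [-> Gab _]]]] := eqVneq i i0.
    by rewrite Ni0 inE eq_sym leaf_neq.
  have Gv0 := degree0 (Gv i); rewrite !inE negb_or.
  by apply/andP; split; apply: contraTneq Gab => <-; rewrite ?Gv0 // (sG i).1 Gv0.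
exists (fun i => attach (G i) v (N i)); split=> [i|i x|i j ij].
- exact: attach_simple.
- have [->|xv] := eqVneq x v.
    rewrite degree_attach_new //.
    have [->|ii0] := eqVneq i i0; first by rewrite Ni0 cards1 leaf_v.
    by have [a [b [-> _ ab]]] := NE i ii0; rewrite cards2 ab deg2_v.
  have := degree_attach_old (N i) (sG i) (Gv i) xv.
  rewrite dG -(delete_leafK i xv).
  have [->|ii0] := eqVneq i i0.
    rewrite Ni0 inE; case: eqP => [->|_] /=; last by lia.
    suff ->: [set y in [set w] | G i0 w y] = set0 by rewrite cards0; lia.
    apply/setP=> y; rewrite !inE; case: eqP => //= ->.
    by rewrite (sG i0).2.
  have [a [b [-> Gab ab]]] := NE i ii0; rewrite addn0.
  case xab: (x \in [set a; b]); last by lia.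
  (* Each end of the subdivided edge trades the other end for [v]. *)
  suff ->: #|[set y in [set a; b] | G i x y]| = 1 by lia.
  have [Gs Gi] := sG i; move: xab; rewrite !inE => /orP[]/eqP->.
    rewrite -(cards1 b); apply: eq_card => y; rewrite !inE.
    by have [->|yb] := eqVneq y b; rewrite ?orbT ?orbF //; case: eqP => // ->; rewrite Gi.
  rewrite -(cards1 a); apply: eq_card => y; rewrite !inE.
  have [->|ya] := eqVneq y a; first by rewrite Gs.
  by case: eqP => // ->; rewrite Gi.
- exact: attach_disjoint (Nd _ _ ij) _ _ (disG _ _ ij).
Qed.

End DeleteLeaf.

(** * The induction on the number of vertices *)

Lemma packing_instance_packs (V : finType) (k : nat) (A : {set V})
    (D : 'I_k -> V -> nat) :
  packing_instance A D -> 2 * k - 4 <= #|never_leaves_in A D| ->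
  exists G, packs D G.
Proof.
move En : #|A| => n; elim: n A D En => [|n IH] A D cA pD nev.
  (* Without vertices the degree sum equation is impossible, so there are no indices. *)
  exists (fun _ _ _ => false); split=> i; have := pack_sum pD i; rewrite cA; lia.
(* The summand [D i0 w == 2] pays for the never-leaf that may be lost at [w]. *)
have step i0 v w : D i0 v = 1 -> (forall j, j != i0 -> D j v = 2) ->
    1 < D i0 w -> (D i0 w = 2 -> forall j, j != i0 -> 1 < D j w) ->
    2 * k - 4 + (D i0 w == 2) <= #|never_leaves_in A D| -> exists G, packs D G.
  move=> Dv Dj Dw Dw2 nev'.
  have pD' := delete_leaf_instance pD Dv Dj Dw Dw2.
  have nev2 : 2 * k - 4 <= #|never_leaves_in (A :\ v) (delete_leaf D i0 v w)|.
    by have := never_leaves_delete_leaf A Dv Dw; move: nev'; lia.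
  have [|G] := IH _ _ _ pD' nev2; last exact: (reinsert_leaf Dv Dj Dw pD' nev2).
  by have := cA; rewrite (cardsD1 v A) -(pack_support pD i0) Dv add1n => -[].
have [/existsP[i /existsP[w Dw]]|/existsPn small] :=
    boolP [exists i, exists w, 2 < D i w].
  have [i0 [v [x [Dv Dj Dx]]]] := branching_leaf pD Dw.
  by apply: (step i0 v x) => //; move: Dx nev; lia.
have D2 i v : D i v <= 2 by rewrite leqNgt; apply: (existsPn (small i)).
have [eq_nev|lt_nev] := leqP #|never_leaves_in A D| (2 * k - 4).
  (* Truncation makes [2 * (k - 2)] the right count for [k < 2] too. *)
  by apply: (@paths_pack _ _ _ _ (k - 2) pD D2); lia.
case: (posnP k) => [k0|k_gt0].
  by exists (fun _ _ _ => false); split=> i; have := ltn_ord i; lia.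
pose i0 := Ordinal k_gt0.
have [v] : exists v, v \in leaves (D i0).
  by apply/card_gt0P; rewrite (card_leaves pD).
rewrite inE => /eqP Dv.
(* This [w] has degree 2 in every sequence; the strict bound [lt_nev] allows it to become a leaf. *)
have /card_gt0P[w] : 0 < #|never_leaves_in A D| by apply: leq_trans lt_nev.
rewrite inE => /andP[wA /forallP nev_w].
have Dw j : 1 < D j w.
  by have := nev_w j; have := pack_support pD j w; rewrite wA; lia.
apply: (step i0 v w) => // [j ji|]; last by rewrite addnC; case: eqP; lia.
by have := pack_leaves pD ji Dv; have := D2 j v; lia.
Qed.

Theorem theorem4 (n k : nat) (D : 'I_k -> 'I_n -> nat)
    (D_tree : forall i, tree_degree_sequence (D i))
    (D_leaves : no_common_leaves D)
    (D_never : 2 * k - 4 <= #|never_leaves D|) :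
  edge_disjoint_realizations D.
Proof.
have pD : packing_instance [set: 'I_n] D.
  split=> [i v|i|]; last exact: D_leaves.
    by rewrite inE (D_tree i).1.
  by rewrite (D_tree i).2 cardsT card_ord.
have [|G [sG dG disG]] := packing_instance_packs pD.
  by rewrite (eq_card (B := never_leaves D)) // => v; rewrite !inE.
by exists G; split=> // i; split.
Qed.
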